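(* For $m,n\ge0$ the object $\Omega_{m+n}$, together with $$q_1:=(\mathrm{pr}_{\mathbb{R}^m}\circ\mathrm{pr}_{\mathbb{R}^{m+n}},\ \Theta_1):\Omega_{m+n}\to\Omega_m,\qquad q_2:=(\mathrm{pr}_{\mathbb{R}^n}\circ\mathrm{pr}_{\mathbb{R}^{m+n}},\ \Theta_2):\Omega_{m+n}\to\Omega_n,$$ where $\mathbb{R}^{m+n}=\mathbb{R}^m\times\mathbb{R}^n$ (i.e. $q_1((s,t),\omega)=(s,\Theta_1\omega)$, $q_2((s,t),\omega)=(t,\Theta_2\omega)$), is a product of $\Omega_m$ and $\Omega_n$ in the category $\mathbb{S}$. Consequently $\mathbb{S}$ has all finite non-empty products. It has no terminal object: $\mathbb{S}(\Omega_0,\Omega_0)=\Omega^\Omega$ has more than one element, and for $n\ge1$ so does $\mathbb{S}(\Omega_0,\Omega_n)$, which contains the distinct morphisms $\iota^n_{t_0}:\omega\mapsto(t_0,\omega)$, $t_0\in\mathbb{R}^n$.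
   Context: **Sample space.** $\Omega=[0,1]^{\mathbb{N}}$; $\mathcal{B}_\Omega$ is the universal completion of its Borel (product) $\sigma$-algebra, i.e. all universally measurable subsets; $\Omega^\Omega$ is the set of all $\mathcal{B}_\Omega$-$\mathcal{B}_\Omega$-measurable self-maps of $\Omega$. $\Theta=(\Theta_1,\Theta_2):\Omega\to\Omega\times\Omega$ is the Borel isomorphism de-interleaving the coordinates of a sequence (e.g. even- and odd-indexed coordinates). **Site.** $\Omega_n:=\mathbb{R}^n\times\Omega$, $n\ge0$ ($\Omega_0=\Omega$). A map $g:\Omega_m\to\mathbb{R}^n$ is mixed-smooth, $g\in\mathcal{C}^\infty_{\mathrm{mix}}(\Omega_m,\mathbb{R}^n)$, if (M1) $g(-,\omega)\in C^\infty(\mathbb{R}^m,\mathbb{R}^n)$ for every $\omega$, and (M2) $g(t,-)$ is $\mathcal{B}_\Omega$-Borel measurable for every $t$. The category $\mathbb{S}$ has objects $\Omega_n$, $n\ge0$, and morphisms $\mathbb{S}(\Omega_m,\Omega_n)=\{(g,\Phi): g\in\mathcal{C}^\infty_{\mathrm{mix}}(\Omega_m,\mathbb{R}^n),\Phi\in\Omega^\Omega\}$, where $(g,\Phi)(t,\omega)=(g(t,\omega),\Phi(\omega))$, composed as maps. *)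

(* Defs.v *)
From HB Require Import structures.
From mathcomp Require Import all_boot all_order all_algebra.
From mathcomp Require Import all_classical all_reals all_analysis.
From mathcomp Require Import measurable_realfun.

Set Implicit Arguments.
Unset Strict Implicit.
Unset Printing Implicit Defensive.
Import Order.TTheory GRing.Theory Num.Theory.
Import numFieldNormedType.Exports.
Local Open Scope classical_set_scope.
Local Open Scope ring_scope.

Record category := Category {
  Ob : Type;
  Mor : Ob -> Ob -> Type;
  idmor : forall a, Mor a a;
  compose : forall a b c, Mor b c -> Mor a b -> Mor a c;
  compose_idl : forall a b (f : Mor a b), compose (idmor b) f = f;
  compose_idr : forall a b (f : Mor a b), compose f (idmor a) = f;
  compose_assoc : forall a b c d (h : Mor c d) (g : Mor b c) (f : Mor a b),
    compose h (compose g f) = compose (compose h g) f }.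

Arguments compose {_ _ _ _} _ _.

Definition is_product (C : category) (a b p : Ob C)
    (p1 : Mor p a) (p2 : Mor p b) : Prop :=
  forall (x : Ob C) (f : Mor x a) (g : Mor x b),
    exists! h : Mor x p, compose p1 h = f /\ compose p2 h = g.

Definition is_family_product (C : category) (I : Type) (F : I -> Ob C)
    (p : Ob C) (pr : forall i, Mor p (F i)) : Prop :=
  forall (x : Ob C) (f : forall i, Mor x (F i)),
    exists! h : Mor x p, forall i, compose (pr i) h = f i.

Definition has_finite_nonempty_products (C : category) : Prop :=
  forall (I : finType) (F : I -> Ob C), (0 < #|I|)%N ->
    exists (p : Ob C) (pr : forall i, Mor p (F i)), is_family_product pr.

Definition is_terminal (C : category) (t : Ob C) : Prop :=
  forall x : Ob C, exists! f : Mor x t, True.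

(* On a finite-dimensional [V], the map
   [x |-> 'd f x] is of class C^k for the operator norm if and only if
   [x |-> 'd f x v] is for every vector [v]. *)
Fixpoint class_C (R : realType) (V W : normedModType R) (k : nat)
    (f : V -> W) : Prop :=
  if k is k'.+1 then
    (forall x, differentiable f x) /\
    (forall v, class_C k' (fun x => 'd f x v))
  else continuous f.

Definition smooth (R : realType) (V W : normedModType R) (f : V -> W) : Prop :=
  forall k, class_C k f.

Lemma class_C_cont (R : realType) (V W : normedModType R) k (f : V -> W) :
  class_C k f -> continuous f.
Proof.
case: k => [//|k] [df _] x; exact: differentiable_continuous.
Qed.

Lemma class_CW (R : realType) (V W : normedModType R) k (f : V -> W) :
  class_C k.+1 f -> class_C k f.
Proof.
elim: k f => [|k IH] f; first exact: class_C_cont.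
by move=> [df Cf]; split=> // v; apply: IH.
Qed.

Lemma class_C_cst (R : realType) (V W : normedModType R) k (w : W) :
  class_C k (fun _ : V => w).
Proof.
elim: k w => [|k IH] w; first exact: cst_continuous.
split=> [x|v]; first exact: differentiable_cst.
rewrite (_ : (fun x => _) = (fun=> 0)); first exact: IH.
by apply/funext => x; rewrite (@diff_cst R V W w x).
Qed.

Lemma class_C_lin (R : realType) (V W : normedModType R) k
    (f : {linear V -> W}) : continuous f -> class_C k f.
Proof.
case: k => [//|k] cf; split=> [x|v].
  by apply: linear_differentiable; exact: cf.
rewrite (_ : (fun x => _) = (fun=> f v)); first exact: class_C_cst.
by apply/funext => x; rewrite diff_lin//; exact: cf.
Qed.

Lemma class_CD (R : realType) (V W : normedModType R) k (f g : V -> W) :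
  class_C k f -> class_C k g -> class_C k (fun x => f x + g x).
Proof.
elim: k f g => [|k IH] f g.
  by move=> cf cg x; apply: continuousD; [exact: cf|exact: cg].
move=> [df Cf] [dg Cg]; split=> [x|v]; first exact: differentiableD.
rewrite (_ : (fun x => _) = (fun x => 'd f x v + 'd g x v)).
  exact: (IH _ _ (Cf v) (Cg v)).
by apply/funext => x; rewrite (@diffD R V W f g x).
Qed.

Lemma class_C_sum (R : realType) (V W : normedModType R) k n
    (f : 'I_n -> V -> W) :
  (forall i, class_C k (f i)) -> class_C k (fun x => \sum_(i < n) f i x).
Proof.
elim: n f => [|n IH] f Cf.
  rewrite (_ : (fun x => _) = (fun=> 0)); first exact: class_C_cst.
  by apply/funext => x; rewrite big_ord0.
rewrite (_ : (fun x => _) =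
    (fun x => \sum_(i < n) f (widen_ord (leqnSn n) i) x + f ord_max x)).
  by apply: class_CD => //; apply: IH.
by apply/funext => x; rewrite big_ord_recr.
Qed.

Lemma class_CM (R : realType) (V : normedModType R) k (f g : V -> R) :
  class_C k f -> class_C k g -> class_C k (fun x => f x * g x).
Proof.
elim: k f g => [|k IH] f g.
  by move=> cf cg x; apply: continuousM; [exact: cf|exact: cg].
move=> Cf1 Cg1; have [df Cf] := Cf1; have [dg Cg] := Cg1.
split=> [x|v]; first exact: differentiableM.
rewrite (_ : (fun x => _) = (fun x => f x * 'd g x v + g x * 'd f x v)).
  apply: class_CD.
    exact: (IH _ _ (class_CW Cf1) (Cg v)).
  exact: (IH _ _ (class_CW Cg1) (Cf v)).
by apply/funext => x; rewrite (@diffM R V f g x).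
Qed.

Lemma diff_coord (R : realType) (V : normedModType R) n (f : V -> 'rV[R]_n)
    (j : 'I_n) (x : V) : differentiable f x ->
  differentiable (fun y => f y ord0 j : R) x /\
  forall v, 'd (fun y => f y ord0 j : R) x v = 'd f x v ord0 j.
Proof.
move=> df.
have @c : {linear 'rV[R]_n -> R}.
  by exists (fun N : 'rV[R]_n => N ord0 j); do 2![eexists]; do ?[constructor];
     rewrite ?mxE// => ? *; rewrite ?mxE//; move=> ?; rewrite !mxE.
have cc : continuous c by exact: coord_continuous.
have dc : differentiable c (f x) by exact/linear_differentiable/cc.
split; first exact: (@differentiable_comp R V _ _ f c x df dc).
by move=> v; rewrite (@diff_comp R V _ _ f c x df dc) /= (diff_lin _ cc).
Qed.

Lemma class_C_coord (R : realType) (V : normedModType R) n k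
    (f : V -> 'rV[R]_n) (j : 'I_n) :
  class_C k f -> class_C k (fun x => f x ord0 j : R).
Proof.
elim: k f => [|k IH] f.
  move=> cf x.
  apply: (@continuous_comp _ _ _ f (fun N : 'rV[R]_n => N ord0 j)).
    exact: cf.
  exact: coord_continuous.
move=> [df Cf]; split=> [x|v]; first exact: (diff_coord j (df x)).1.
rewrite (_ : (fun x => _) = (fun x => 'd f x v ord0 j)).
  exact: (IH _ (Cf v)).
by apply/funext => x; rewrite (diff_coord j (df x)).2.
Qed.

Lemma class_CZ (R : realType) (V W : normedModType R) k (f : V -> R) (w : W) :
  class_C k f -> class_C k (fun x => f x *: w).
Proof.
elim: k f => [|k IH] f.
  by move=> cf x; apply: cvgZr_tmp; exact: cf.
move=> [df Cf]; split=> [x|v]; first exact: differentiableZl.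
rewrite (_ : (fun x => _) = (fun x => 'd f x v *: w)).
  exact: (IH _ (Cf v)).
by apply/funext => x; rewrite diffZl.
Qed.

Lemma class_C_rV (R : realType) (V : normedModType R) n k (f : V -> 'rV[R]_n) :
  (forall j, class_C k (fun x => f x ord0 j : R)) -> class_C k f.
Proof.
move=> Cf.
rewrite (_ : f = (fun x => \sum_(j < n) f x ord0 j *: delta_mx ord0 j)).
  by apply: class_C_sum => j; apply: class_CZ; exact: Cf.
by apply/funext => x; rewrite -row_sum_delta.
Qed.

Lemma class_C_comp (R : realType) (V : normedModType R) n p k
    (f : V -> 'rV[R]_n) (g : 'rV[R]_n -> 'rV[R]_p) :
  class_C k f -> class_C k g -> class_C k (g \o f).
Proof.
elim: k g => [|k IH] g.
  by move=> cf cg x; apply: continuous_comp; [exact: cf|exact: cg].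
move=> Cf1 [dg Cg]; have [df Cf] := Cf1.
split=> [x|v]; first exact: differentiable_comp.
rewrite (_ : (fun x => _) = (fun x => \sum_(j < n)
    'd f x v ord0 j *: 'd g (f x) (delta_mx ord0 j))).
  apply: class_C_sum => j; apply: class_C_rV => i.
  rewrite (_ : (fun x => _) = (fun x => 'd f x v ord0 j *
      'd g (f x) (delta_mx ord0 j) ord0 i)).
    apply: class_CM; first exact: (class_C_coord j (Cf v)).
    exact: (class_C_coord i (IH _ (class_CW Cf1) (Cg _))).
  by apply/funext => x; rewrite mxE.
apply/funext => x; rewrite diff_comp//= [in LHS](row_sum_delta ('d f x v)).
by rewrite linear_sum; apply: eq_bigr => j _; rewrite linearZ.
Qed.

Lemma smooth_comp (R : realType) (V : normedModType R) n p
    (f : V -> 'rV[R]_n) (g : 'rV[R]_n -> 'rV[R]_p) :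
  smooth f -> smooth g -> smooth (g \o f).
Proof. by move=> sf sg k; apply: class_C_comp. Qed.

Lemma smooth_lin (R : realType) m n (f : {linear 'rV[R]_m -> 'rV[R]_n}) :
  smooth f.
Proof.
move=> k; apply: class_C_rV => j.
rewrite (_ : (fun x => _) =
  (fun x : 'rV[R]_m => \sum_(i < m) x ord0 i * f (delta_mx ord0 i) ord0 j)).
  apply: class_C_sum => i; apply: class_CM; last exact: class_C_cst.
  apply: (class_C_coord i (f := idfun)); apply: class_C_lin.
  by move=> x; exact: cvg_id.
apply/funext => x; rewrite [in LHS](row_sum_delta x) linear_sum summxE.
by apply: eq_bigr => i _; rewrite linearZ mxE.
Qed.

Definition univ_measurable (R : realType) d (T : measurableType d) :
    set (set T) :=
  [set A | forall mu : probability T R, completed_algebra_gen mu A].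

Lemma univ_measurableP (R : realType) d (T : measurableType d) (A : set T) :
  univ_measurable R A <-> forall mu : probability T R,
    exists X Y, [/\ measurable X, measurable Y, X `<=` A, A `<=` Y &
      mu (Y `\` X) = 0%E].
Proof.
split=> uA mu.
  have [X mX [N [Y [mY Y0 NY]] <-]] := uA mu.
  exists X, (X `|` Y); split.
  - by [].
  - exact: measurableU.
  - by move=> x; left.
  - by move=> x [Xx|/NY Yx]; [left|right].
  - apply/eqP; rewrite -measure_le0 -Y0.
    apply: le_measure; rewrite ?inE//; last by move=> x [[|]].
    by apply: measurableD => //; exact: measurableU.
have [X [Y [mX mY XA AY YX0]]] := uA mu.
exists X => //; exists (A `\` X); last by rewrite setDUK.
exists (Y `\` X); split=> //; first exact: measurableD.
by apply: setSD.
Qed.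

Lemma univ_measurable_sub (R : realType) d (T : measurableType d) (A : set T) :
  measurable A -> univ_measurable R A.
Proof.
move=> mA mu; exists A => //; exists set0; last by rewrite setU0.
exact: negligible_set0.
Qed.

Lemma univ_measurable0 (R : realType) d (T : measurableType d) :
  univ_measurable R (@set0 T).
Proof. exact: univ_measurable_sub. Qed.

Lemma univ_measurableC (R : realType) d (T : measurableType d) (A : set T) :
  univ_measurable R A -> univ_measurable R (~` A).
Proof.
move=> /univ_measurableP uA; apply/univ_measurableP => mu.
have [X [Y [mX mY XA AY YX0]]] := uA mu.
exists (~` Y), (~` X); split; [exact: measurableC|exact: measurableC
  |exact: subsetC|exact: subsetC|].
by rewrite setDE setCK setIC -setDE.
Qed.

Lemma univ_measurable_bigcup (R : realType) d (T : measurableType d)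
    (F : (set T)^nat) :
  (forall i, univ_measurable R (F i)) -> univ_measurable R (\bigcup_i F i).
Proof.
move=> uF mu.
have /choice[X /choice[Y XY]] : forall i, exists X Y,
    [/\ measurable X, measurable Y, X `<=` F i, F i `<=` Y &
      mu (Y `\` X) = 0%E].
  by move=> i; exact: ((univ_measurableP R (F i)).1 (uF i) mu).
exists (\bigcup_i X i).
  by apply: bigcupT_measurable => i; case: (XY i).
exists (\bigcup_i F i `\` \bigcup_i X i).
  apply: (@negligibleS _ _ _ _ (\bigcup_i (Y i `\` X i))).
    move=> x [[i _ Fi] nX]; exists i => //; split.
      by case: (XY i) => _ _ _ + _; apply.
    by move=> Xi; apply: nX; exists i.
  apply: negligible_bigcup => i; have [mX mY _ _ YX0] := XY i.
  by apply/negligibleP => //; exact: measurableD.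
rewrite setDUK//; apply: subset_bigcup => i _.
by case: (XY i).
Qed.

Definition univ_completion (R : realType) d (T : measurableType d) : Type := T.

Definition univ_display : measure_display -> measure_display.
Proof. exact. Qed.

HB.instance Definition _ (R : realType) d (T : measurableType d) :=
  Pointed.on (univ_completion R T).
HB.instance Definition _ (R : realType) d (T : measurableType d) :=
  @isMeasurable.Build (univ_display d) (univ_completion R T)
    (@univ_measurable R d T) (@univ_measurable0 R d T)
    (@univ_measurableC R d T) (@univ_measurable_bigcup R d T).

Lemma measurable_univ_completion (R : realType) d d' (T : measurableType d)
    (T' : measurableType d') (f : T -> T') :
  measurable_fun [set: T] f ->
  measurable_fun [set: univ_completion R T]
    (f : univ_completion R T -> univ_completion R T').
Proof.
move=> mf _ A mA; rewrite setTI.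
apply/(@univ_measurableP R d T) => mu.
pose F : {mfun T >-> T'} :=
  HB.pack f (isMeasurableFun.Build _ _ _ _ f mf).
have [X [Y [mX mY XA AY YX0]]] :=
  (@univ_measurableP R d' T' A).1 mA (distribution mu F).
exists (f @^-1` X), (f @^-1` Y); split.
- exact: (measurable_funPTI F mX).
- exact: (measurable_funPTI F mY).
- exact: preimage_subset.
- exact: preimage_subset.
- exact: YX0.
Qed.

Definition mfun_of d d' (T : measurableType d) (T' : measurableType d')
    (f : T -> T') (mf : measurable_fun [set: T] f) : {mfun T >-> T'} :=
  HB.pack f (isMeasurableFun.Build _ _ _ _ f mf).

Definition unit_interval (R : realType) : Type := {x : R | 0 <= x <= 1}.

Lemma unit_interval0 (R : realType) : (0 : R) <= (0 : R) <= (1 : R).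
Proof. by rewrite lexx (@ler01 R). Qed.

HB.instance Definition _ (R : realType) := Choice.on (unit_interval R).
HB.instance Definition _ (R : realType) :=
  isPointed.Build (unit_interval R) (exist _ 0 (unit_interval0 R)).

Definition seq01 (R : realType) : Type := nat -> unit_interval R.

HB.instance Definition _ (R : realType) := Pointed.on (seq01 R).

(* As [0,1] is second countable, the sigma-algebra generated by the cylinders is
   the Borel sigma-algebra of the product topology. *)
Definition cylinder (R : realType) : set (set (seq01 R)) :=
  [set A | exists (k : nat) (B : set R),
     measurable B /\ A = [set w | B (sval (w k))]].

Definition borel_seq01 (R : realType) := g_sigma_algebraType (@cylinder R).

Definition Omega (R : realType) := univ_completion R (borel_seq01 R).

Definition borel_rV (R : realType) (n : nat) :=
  g_sigma_algebraType (@open 'rV[R]_n).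

Definition subseq01 (R : realType) (s : nat -> nat) (w : Omega R) : Omega R :=
  fun k => w (s k).

Lemma measurable_subseq01 (R : realType) (s : nat -> nat) :
  measurable_fun [set: Omega R] (@subseq01 R s).
Proof.
apply: (@measurable_univ_completion R _ _ (borel_seq01 R) (borel_seq01 R)).
apply: (@measurability _ _ (borel_seq01 R) (borel_seq01 R) setT
  (@subseq01 R s) (@cylinder R)) => //.
move=> _ [_ [k [B [mB ->]]] <-]; rewrite setTI.
by apply: sub_sigma_algebra; exists (s k), B.
Qed.

Definition Theta1 (R : realType) : {mfun Omega R >-> Omega R} :=
  mfun_of (@measurable_subseq01 R (fun k => k.*2)).

Definition Theta2 (R : realType) : {mfun Omega R >-> Omega R} :=
  mfun_of (@measurable_subseq01 R (fun k => k.*2.+1)).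

Definition Omega_ (R : realType) (n : nat) : Type := ('rV[R]_n * Omega R)%type.

Definition mixed_smooth (R : realType) (m n : nat)
    (g : Omega_ R m -> 'rV[R]_n) : Prop :=
  (forall w, smooth (fun t => g (t, w))) /\
  (forall t, measurable_fun [set: Omega R] (fun w => g (t, w) : borel_rV R n)).

(* A morphism is the pair (g, Phi); by [hom_map_inj] and [hom_map_comp] it is
   determined by the induced map, and composition is that of the maps. *)
Record site_hom (R : realType) (m n : nat) : Type := SiteHom {
  hom_rV : Omega_ R m -> 'rV[R]_n;
  hom_Omega : {mfun Omega R >-> Omega R};
  hom_rVP : mixed_smooth hom_rV }.

Definition hom_map (R : realType) (m n : nat) (f : site_hom R m n)
    (x : Omega_ R m) : Omega_ R n := (hom_rV f x, hom_Omega f x.2).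

Lemma hom_map_inj (R : realType) (m n : nat) : injective (@hom_map R m n).
Proof.
move=> [g1 F1 p1] [g2 F2 p2] /= e.
have eg : g1 = g2 by apply/funext => x; have := congr1 (fun h => (h x).1) e.
have eF : F1 = F2.
  by apply/mfuneqP => w; have := congr1 (fun h => (h (0, w)).2) e.
by subst; congr SiteHom; exact: Prop_irrelevance.
Qed.

Lemma rV_rat_dense (R : realType) n (t : 'rV[R]_n) (e : R) : 0 < e ->
  exists q : 'rV[rat]_n, ball t e (map_mx ratr q).
Proof.
move=> e0.
have /choice[q qP] : forall j : 'I_n, exists q : rat, ball (t ord0 j) e (ratr q).
  move=> j; have : t ord0 j < t ord0 j + e by rewrite ltrDl.
  move=> /rat_in_itvoo[q]; rewrite in_itv/= => /andP[q1 q2]; exists q.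
  by rewrite /ball/= distrC gtr0_norm ?subr_gt0// ltrBlDl.
exists (\row_j q j); split=> // i j.
by rewrite !mxE (ord1 i); exact: qP.
Qed.

Lemma measurable_caratheodory (R : realType) d (T : measurableType d) (n p : nat)
    (g : 'rV[R]_n -> T -> 'rV[R]_p) (h : T -> 'rV[R]_n) :
  (forall w, continuous (fun t => g t w)) ->
  (forall t, measurable_fun [set: T] (g t : T -> borel_rV R p)) ->
  measurable_fun [set: T] (h : T -> borel_rV R n) ->
  measurable_fun [set: T] (fun w => g (h w) w : borel_rV R p).
Proof.
move=> cg mg mh.
apply: (@measurability _ _ T (borel_rV R p) setT _ (@open 'rV[R]_p)) => //.
move=> _ [U oU <-]; rewrite setTI.
pose e (k : nat) : R := k.+1%:R^-1.
have e_gt0 k : 0 < e k by rewrite invr_gt0.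
pose UI k : set 'rV[R]_p := [set y | ball y (e k) `<=` U].
pose rq (q : 'rV[rat]_n) : 'rV[R]_n := map_mx ratr q.
rewrite (_ : _ @^-1` _ = \bigcup_k ~` \bigcup_(q : 'rV[rat]_n)
  ([set w | ball (rq q) (e k) (h w)] `\`
   [set w | UI k (g (rq q) w)])).
  apply: bigcupT_measurable => k; apply: measurableC.
  apply: countable_bigcupT_measurable; first exact: countableP.
  move=> q; apply: measurableD.
    rewrite -[X in measurable X]setTI; apply: mh => //.
    by apply: sub_sigma_algebra; exact: ball_open.
  rewrite -[X in measurable X]setTI; apply: mg => //.
  rewrite -[UI k]setCK; apply: (@measurableC _ (borel_rV R p)).
  apply: sub_sigma_algebra => /=.
  rewrite (_ : ~` UI k = \bigcup_(z in ~` U) ball (z : 'rV[R]_p) (e k)).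
    by apply: bigcup_open => z _; exact: ball_open.
  apply/seteqP; split=> y /=.
    move=> /existsNP[z] /not_implyP[yz nUz]; exists z => //.
    exact: ball_sym.
  by move=> [z nUz zy] yU; apply: nUz; apply: yU; exact: ball_sym.
apply/seteqP; split=> w /=.
  move=> Uw.
  have /nbhs_ballP[r /= r0 rU] : nbhs (g (h w) w) U.
    by move: oU; rewrite openE; apply.
  have r20 : 0 < r / 2 by rewrite divr_gt0.
  have /nbhs_ballP[s /= s0 sg] := cg w (h w) _ (nbhsx_ballx _ _ r20).
  have m0 : 0 < Num.min (r / 2) s by rewrite lt_min r20 s0.
  have [k _ /(_ k (leqnn k)) ek] := near_infty_natSinv_lt (PosNum m0).
  move: ek; rewrite /= lt_min => /andP[er es].
  exists k => // -[q _ [/= hq]]; apply => z /= gz.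
  apply: rU; rewrite (splitr r); apply: ball_triangle (le_ball (ltW er) gz).
  apply: sg; apply: ball_sym; exact: le_ball (ltW es) _ hq.
move=> [k _ Hk].
have /nbhs_ballP[s /= s0 sg] := cg w (h w) _ (nbhsx_ballx _ _ (e_gt0 k)).
have m0 : 0 < Num.min (e k) s by rewrite lt_min e_gt0 s0.
have [q hq] := rV_rat_dense (h w) m0.
have : UI k (g (rq q) w).
  apply: contrapT => nU; apply: Hk; exists q => //; split=> //=.
  by apply: ball_sym; apply: le_ball hq; rewrite ge_min lexx.
apply; apply: ball_sym; apply: sg; apply: le_ball hq.
by rewrite ge_min lexx orbT.
Qed.

Lemma mixed_smooth_id (R : realType) (m : nat) :
  mixed_smooth (fun x : Omega_ R m => x.1).
Proof.
split=> [w|t]; last exact: measurable_cst.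
exact: (@smooth_lin R m m idfun).
Qed.

Definition site_id (R : realType) (m : nat) : site_hom R m m :=
  SiteHom (mfun_of (@measurable_id _ (Omega R) setT)) (@mixed_smooth_id R m).

Lemma mixed_smooth_comp (R : realType) (m n p : nat)
    (g : site_hom R n p) (f : site_hom R m n) :
  mixed_smooth (fun x => hom_rV g (hom_map f x)).
Proof.
case: g f => [g Psi [sg mg]] [f Phi [sf mf]]; split=> [w|t] /=.
  exact: (smooth_comp (sf w) (sg (Phi w))).
apply: (@measurable_caratheodory R _ _ n p (fun s w => g (s, Phi w))
  (fun w => f (t, w))).
- by move=> w; apply: (class_C_cont (sg (Phi w) 0)).
- move=> s; apply: (measurableT_comp (mg s)); exact: measurable_funPT.
- exact: mf.
Qed.

Definition site_comp (R : realType) (m n p : nat)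
    (g : site_hom R n p) (f : site_hom R m n) : site_hom R m p :=
  SiteHom [the {mfun Omega R >-> Omega R} of hom_Omega g \o hom_Omega f]
    (mixed_smooth_comp g f).

Lemma hom_map_id (R : realType) (m : nat) : hom_map (site_id R m) = id.
Proof. by apply/funext => -[t w]. Qed.

Lemma hom_map_comp (R : realType) (m n p : nat)
    (g : site_hom R n p) (f : site_hom R m n) :
  hom_map (site_comp g f) = hom_map g \o hom_map f.
Proof. by []. Qed.

Lemma site_comp_idl (R : realType) (m n : nat) (f : site_hom R m n) :
  site_comp (site_id R n) f = f.
Proof. by apply: hom_map_inj; rewrite hom_map_comp hom_map_id. Qed.

Lemma site_comp_idr (R : realType) (m n : nat) (f : site_hom R m n) :
  site_comp f (site_id R m) = f.
Proof. by apply: hom_map_inj; rewrite hom_map_comp hom_map_id. Qed.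

Lemma site_comp_assoc (R : realType) (m n p q : nat) (h : site_hom R p q)
    (g : site_hom R n p) (f : site_hom R m n) :
  site_comp h (site_comp g f) = site_comp (site_comp h g) f.
Proof. exact: hom_map_inj. Qed.

(* The object [n] of [site R] stands for [Omega_ R n]. *)
Definition site (R : realType) : category :=
  @Category nat (@site_hom R) (@site_id R) (@site_comp R)
    (@site_comp_idl R) (@site_comp_idr R) (@site_comp_assoc R).

Lemma mixed_smooth_pr1 (R : realType) (m n : nat) :
  mixed_smooth (fun x : Omega_ R (m + n) => lsubmx x.1).
Proof.
split=> [w|t]; last first.
  exact: (@measurable_cst _ _ (Omega R) (borel_rV R m) setT (_ t)).
exact: (@smooth_lin R (m + n) m lsubmx).
Qed.

Lemma mixed_smooth_pr2 (R : realType) (m n : nat) :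
  mixed_smooth (fun x : Omega_ R (m + n) => rsubmx x.1).
Proof.
split=> [w|t]; last first.
  exact: (@measurable_cst _ _ (Omega R) (borel_rV R n) setT (_ t)).
exact: (@smooth_lin R (m + n) n rsubmx).
Qed.

Definition q1 (R : realType) (m n : nat) : site_hom R (m + n) m :=
  SiteHom (Theta1 R) (@mixed_smooth_pr1 R m n).

Definition q2 (R : realType) (m n : nat) : site_hom R (m + n) n :=
  SiteHom (Theta2 R) (@mixed_smooth_pr2 R m n).

Lemma q1E (R : realType) (m n : nat) (s : 'rV[R]_m) (t : 'rV[R]_n)
    (w : Omega R) :
  hom_map (q1 R m n) (row_mx s t, w) = (s, Theta1 R w).
Proof. by rewrite /hom_map /= row_mxKl. Qed.

Lemma q2E (R : realType) (m n : nat) (s : 'rV[R]_m) (t : 'rV[R]_n)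
    (w : Omega R) :
  hom_map (q2 R m n) (row_mx s t, w) = (t, Theta2 R w).
Proof. by rewrite /hom_map /= row_mxKr. Qed.

Lemma mixed_smooth_cst (R : realType) (m n : nat) (t0 : 'rV[R]_n) :
  mixed_smooth (fun _ : Omega_ R m => t0).
Proof.
split=> [w k|t]; first exact: class_C_cst.
exact: measurable_cst.
Qed.

Definition iota_hom (R : realType) (n : nat) (t0 : 'rV[R]_n) : site_hom R 0 n :=
  SiteHom (mfun_of (@measurable_id _ (Omega R) setT)) (@mixed_smooth_cst R 0 n t0).

(* Main.v *)
Require Import Defs.
From HB Require Import structures.
From mathcomp Require Import all_boot all_order all_algebra.
From mathcomp Require Import all_classical all_reals all_analysis.

Set Implicit Arguments.
Unset Strict Implicit.
Unset Printing Implicit Defensive.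
Import Order.TTheory GRing.Theory Num.Theory.
Import numFieldNormedType.Exports.
Local Open Scope classical_set_scope.
Local Open Scope ring_scope.

(** The pairing of [f = (g1, Phi1)] and [f' = (g2, Phi2)] has vector part
    [(g1, g2)] and sample part the sequence that carries [Phi1] on the even and
    [Phi2] on the odd indices; uniqueness is clear, since a vector is
    determined by its two blocks and a sequence by its two de-interleaved
    halves.  What needs an argument is that this pair is a morphism.

    The sample part must be measurable from the universal completion to the
    universal completion.  Checking coordinates only gives measurability with
    respect to the Borel sets of the codomain.  The upgrade
    ([measurable_univ_completion_codomain]) pushes a probability [mu] forward
    along the map; as the map is only universally measurable, [mu] must first
    be extended to the universally measurable sets, where its outer measure is
    a probability because these sets are Caratheodory measurable.

    The vector part is smooth coordinatewise.  Its measurability in the sample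
    avoids any comparison of the Borel sets of R^(m+n) with products of Borel
    sets: [row_mx s (g2 (t, w))] is continuous in [s] and measurable in [w], so
    the Caratheodory lemma [measurable_caratheodory] lets one substitute
    [s := g1 (t, w)].

    Finite non-empty products are iterated binary ones.  There is no terminal
    object since every [Omega_n] receives two distinct morphisms from
    [Omega_0], for instance those with sample parts the constant sequences 0
    and 1. *)

(** * Measurability into a universal completion *)

Section univ_extension.
Context (R : realType) d (T : measurableType d) (mu : probability T R).

(** A universally measurable set is a Borel set up to a [mu]-negligible one,
    and the Caratheodory sigma-algebra contains both kinds of sets. *)
Lemma univ_measurable_caratheodory (A : set T) :
  univ_measurable R A -> (mu^*)%mu.-cara.-measurable A.
Proof.
move=> /(_ mu)[X mX [N [Y [mY Y0 NY]] <-]].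
apply: measurableU; first exact: caratheodory_measurable_mu_ext.
apply: measure_is_complete_caratheodory; exists Y; split => //.
  exact: caratheodory_measurable_mu_ext.
by transitivity (mu Y) => //; exact: measurable_mu_extE.
Qed.

Definition univ_extension (A : set (univ_completion R T)) : \bar R :=
  (mu^*)%mu A.

Let univ_extension0 : univ_extension set0 = 0%E.
Proof. exact: mu_ext0. Qed.

Let univ_extension_ge0 A : (0 <= univ_extension A)%E.
Proof. exact: mu_ext_ge0. Qed.

Let univ_extension_sigma_additive : semi_sigma_additive univ_extension.
Proof.
move=> F mF tF mUF; apply: caratheodory_measure_sigma_additive => //.
  by move=> i; exact: univ_measurable_caratheodory (mF i).
exact: univ_measurable_caratheodory mUF.
Qed.

HB.instance Definition _ := isMeasure.Build _ _ _ univ_extension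
  univ_extension0 univ_extension_ge0 univ_extension_sigma_additive.

Let univ_extension_setT : univ_extension setT = 1%E.
Proof.
exact: etrans (measurable_mu_extE mu measurableT) (probability_setT mu).
Qed.

HB.instance Definition _ :=
  Measure_isProbability.Build _ _ _ univ_extension univ_extension_setT.

(** Negligibility asks for a null Borel superset; the Borel sandwich of [A]
    provides one, because its lower set has measure at most that of [A]. *)
Lemma negligible_univ_extension (A : set T) :
  univ_measurable R A -> univ_extension A = 0%E -> mu.-negligible A.
Proof.
move=> /univ_measurableP/(_ mu)[X [Y [mX mY XA AY YX0]]] A0.
have X0 : mu X = 0%E.
  apply/eqP; rewrite -measure_le0 -A0.
  by apply: le_trans (le_mu_ext mu XA); rewrite (measurable_mu_extE mu mX).
apply: (@negligibleS _ _ _ _ (X `|` (Y `\` X))).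
  by rewrite setDUK//; exact: subset_trans AY.
apply: negligibleU; apply/negligibleP => //; exact: measurableD.
Qed.

End univ_extension.

(** Pushing the extension of [mu] forward along [f] gives a probability on the
    codomain, which sandwiches [A] between Borel sets [X] and [Y] with null
    difference.  Then [f @^-1` A] lies between [f @^-1` X] and [f @^-1` Y],
    which are universally measurable with [mu]-negligible difference. *)
Lemma measurable_univ_completion_codomain (R : realType) d d'
    (T : measurableType d) (T' : measurableType d')
    (f : univ_completion R T -> T') :
  measurable_fun setT f ->
  measurable_fun setT (f : univ_completion R T -> univ_completion R T').
Proof.
move=> mf _ A mA; rewrite setTI.
suff : univ_measurable R (f @^-1` A : set T) by [].
move=> mu.
have mfX X : measurable X -> univ_measurable R (f @^-1` X : set T).
  by move=> mX; rewrite -[_ @^-1` _]setTI; exact: (mf measurableT X mX).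
have [X [Y [mX mY XA AY YX0]]] :=
  (@univ_measurableP R _ T' A).1 mA (distribution (univ_extension mu) (mfun_of mf)).
have [X1 mX1 [N negN fX]] := mfX X mX mu.
have negYX : mu.-negligible (f @^-1` (Y `\` X) : set T).
  by apply: negligible_univ_extension => //; apply: mfX; exact: measurableD.
exists X1 => //; exists (N `|` f @^-1` (A `\` X)).
  apply: (negligibleU negN); apply: negligibleS negYX.
  by move=> w [/AY].
by rewrite setUA fX -preimage_setU setDUK.
Qed.

(** * Binary products *)

Definition interleave (R : realType) (u v : seq01 R) : seq01 R :=
  fun k => if odd k then v k./2 else u k./2.

Lemma measurable_interleave (R : realType) (Phi Psi : {mfun Omega R >-> Omega R}) :
  measurable_fun [set: Omega R]
    (fun w => interleave (Phi w) (Psi w) : Omega R).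
Proof.
apply: (@measurable_univ_completion_codomain R _ _ (borel_seq01 R)
  (borel_seq01 R)).
apply: (@measurability _ _ (Omega R) (borel_seq01 R) setT _ (@cylinder R)) => //.
move=> _ [_ [k [B [mB ->]]] <-].
have mcoord (F : {mfun Omega R >-> Omega R}) :
    measurable ([set w | B (sval (F w k./2))] : set (Omega R)).
  pose D : set (borel_seq01 R) := [set w | B (sval (w k./2))].
  have mD : univ_measurable R D.
    by apply: univ_measurable_sub; apply: sub_sigma_algebra; exists k./2, B.
  rewrite -[X in measurable X]setTI.
  exact: (measurable_funPT F measurableT D mD).
rewrite setTI /preimage /interleave /=.
by case: (odd k); exact: mcoord.
Qed.

Lemma Theta1_interleave (R : realType) (u v : Omega R) :
  Theta1 R (interleave u v) = u.
Proof.
by apply/funext => k; rewrite /= /subseq01/= /interleave odd_double doubleK.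
Qed.

Lemma Theta2_interleave (R : realType) (u v : Omega R) :
  Theta2 R (interleave u v) = v.
Proof.
apply/funext => k.
by rewrite /= /subseq01/= /interleave/= odd_double uphalf_double.
Qed.

Lemma Theta_inj (R : realType) (u v : Omega R) :
  Theta1 R u = Theta1 R v -> Theta2 R u = Theta2 R v -> u = v.
Proof.
move=> e1 e2; apply/funext => k; rewrite -(odd_double_half k).
by case: (odd k);
  [exact: (congr1 (@^~ k./2) e2)|exact: (congr1 (@^~ k./2) e1)].
Qed.

(** The degenerate case of [measurable_caratheodory] in which the function does
    not depend on the sample. *)
Lemma measurable_continuous_rV (R : realType) d (T : measurableType d) n p
    (f : 'rV[R]_n -> 'rV[R]_p) (h : T -> 'rV[R]_n) :
  continuous f -> measurable_fun setT (h : T -> borel_rV R n) ->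
  measurable_fun setT (f \o h : T -> borel_rV R p).
Proof.
move=> cf mh; apply: (@measurable_caratheodory R _ _ n p (fun t _ => f t)) => //.
Qed.

Lemma smooth_row_mx (R : realType) (V : normedModType R) m n
    (f : V -> 'rV[R]_m) (g : V -> 'rV[R]_n) :
  smooth f -> smooth g -> smooth (fun x => row_mx (f x) (g x)).
Proof.
move=> sf sg k; apply: class_C_rV => j; case: (splitP j) => i ji.
  rewrite (_ : (fun x => _) = (fun x => f x ord0 i)).
    exact: class_C_coord.
  by apply/funext => x; rewrite (_ : j = lshift n i) ?row_mxEl//; exact: val_inj.
rewrite (_ : (fun x => _) = (fun x => g x ord0 i)).
  exact: class_C_coord.
by apply/funext => x; rewrite (_ : j = rshift m i) ?row_mxEr//; exact: val_inj.
Qed.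

Lemma smooth_id (R : realType) m : smooth (@id 'rV[R]_m).
Proof. exact: (@smooth_lin R m m idfun). Qed.

Lemma smooth_cst (R : realType) (V W : normedModType R) (w : W) :
  smooth (fun _ : V => w).
Proof. by move=> k; exact: class_C_cst. Qed.

Lemma mixed_smooth_row_mx (R : realType) (k m n : nat)
    (f : Omega_ R k -> 'rV[R]_m) (g : Omega_ R k -> 'rV[R]_n) :
  mixed_smooth f -> mixed_smooth g ->
  mixed_smooth (fun x => row_mx (f x) (g x)).
Proof.
move=> [sf mf] [sg mg]; split=> [w|t].
  exact: smooth_row_mx (sf w) (sg w).
(* Freeze the first block at [s], then substitute [s := f (t, w)]. *)
apply: (@measurable_caratheodory R _ _ m (m + n)
  (fun s w => row_mx s (g (t, w))) (fun w => f (t, w))) => //.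
  (* Continuity of [row_mx] in one block is a case of its smoothness. *)
  move=> w; apply: (class_C_cont (k := 0)).
  by apply: smooth_row_mx; [exact: smooth_id|exact: smooth_cst].
move=> s; apply: (measurable_continuous_rV _ (mg t)).
apply: (class_C_cont (k := 0)).
by apply: smooth_row_mx; [exact: smooth_cst|exact: smooth_id].
Qed.

Definition site_pair (R : realType) (k m n : nat)
    (f : site_hom R k m) (g : site_hom R k n) : site_hom R k (m + n) :=
  SiteHom (mfun_of (measurable_interleave (hom_Omega f) (hom_Omega g)))
    (mixed_smooth_row_mx (hom_rVP f) (hom_rVP g)).

Lemma site_is_product (R : realType) (m n : nat) :
  @is_product (site R) m n (m + n)%N (q1 R m n) (q2 R m n).
Proof.
move=> k f g; exists (site_pair f g); split=> [|h [<- <-]].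
  split; apply: hom_map_inj; apply/funext => x; rewrite hom_map_comp/=.
    by rewrite q1E Theta1_interleave.
  by rewrite q2E Theta2_interleave.
apply: hom_map_inj; apply/funext => x; congr pair.
  by rewrite /= hsubmxK.
by apply: Theta_inj; [rewrite [LHS]Theta1_interleave|
                      rewrite [LHS]Theta2_interleave].
Qed.

(** * Finite products *)

(** Morphisms out of a product form a dependent family, so a case analysis on
    the index involves a transport along [i = a]; packaging the extended family
    with its two equations keeps that transport inside this proof. *)
Lemma dependent_cons (I : eqType) (Q : I -> Type) (a : I) (s : seq I) (x : Q a)
    (y : forall i, i \in s -> Q i) : a \notin s ->
  exists z : forall i, i \in a :: s -> Q i,
    (forall sa, z a sa = x) /\ (forall i si si', z i si' = y i si).
Proof.
move=> nsa.
have tail i : i \in a :: s -> i <> a -> i \in s.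
  by rewrite inE => /predU1P[].
exists (fun i si => match i =P a with
  | ReflectT e => eq_rect_r Q x e
  | ReflectF ne => y i (tail i si ne) end).
split=> [sa|i si si']; case: eqP => // e.
- by rewrite (eq_irrelevance e erefl).
- by exfalso; move: nsa; rewrite -e si.
- by congr y; exact: bool_irrelevance.
Qed.

(** Induction on a duplicate-free list of indices, in which the product over
    [a :: s] is the binary product of [F a] with the product over [s].  The
    induction starts at singletons, as there may be no terminal object. *)
Lemma binary_to_finite_products (C : category) :
  (forall a b : Ob C, exists (p : Ob C) (p1 : Mor p a) (p2 : Mor p b),
    is_product p1 p2) ->
  has_finite_nonempty_products C.
Proof.
move=> binary I F I_gt0.
pose is_list_product (s : seq I) p (pr : forall i, i \in s -> Mor p (F i)) :=
  forall x (f : forall i, i \in s -> Mor x (F i)),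
    exists! h : Mor x p, forall i (si : i \in s), compose (pr i si) h = f i si.
suff list_product s : uniq s -> s != [::] ->
    exists p pr, @is_list_product s p pr.
  have enumI0 : enum I != [::] by rewrite -size_eq0 -cardE -lt0n.
  have [p [pr prP]] := list_product _ (enum_uniq I) enumI0.
  exists p, (fun i => pr i (mem_enum I i)) => x f.
  have [h [hf h_uniq]] := prP x (fun i _ => f i).
  exists h; split=> // h' h'f; apply: h_uniq => i si.
  by rewrite (bool_irrelevance si (mem_enum I i)) h'f.
elim: s => [//|a s IH] /andP[nsa us] _.
have mem_cons i : i \in s -> i \in a :: s by rewrite inE orbC => ->.
have [s0|s0] := eqVneq s [::].
  have no_tail i : i \in s -> Mor (F a) (F i) by rewrite s0.
  have [pr [pra _]] := dependent_cons (idmor (F a)) no_tail nsa.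
  exists (F a), pr => x f; exists (f a (mem_head a s)); split=> [i si|h hf].
    have ia : i = a by move: (si); rewrite s0 inE => /eqP.
    subst i; rewrite pra compose_idl; congr f; exact: bool_irrelevance.
  by rewrite -hf pra compose_idl.
have [p [pr prP]] := IH us s0.
have [r [r1 [r2 rP]]] := binary (F a) p.
have [pr' [pra prs]] :=
  dependent_cons r1 (fun i si => compose (pr i si) r2) nsa.
exists r, pr' => x f.
have [h2 [h2f h2_uniq]] := prP x (fun i si => f i (mem_cons i si)).
have [h [[h1E h2E] h_uniq]] := rP x (f a (mem_head a s)) h2.
exists h; split=> [i si|h' h'f].
  have [ia|sI] := predU1P (si : (i == a) || (i \in s)).
    by subst i; rewrite pra h1E; congr f; exact: bool_irrelevance.
  by rewrite (prs i sI) -compose_assoc h2E h2f; congr f; exact: bool_irrelevance.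
apply: h_uniq; split; first by rewrite -h'f pra.
symmetry; apply: h2_uniq => i si.
by rewrite compose_assoc -(prs i si (mem_cons i si)) h'f.
Qed.

(** * Morphisms out of Omega_0 *)

(** The sample parts already distinguish two morphisms, which makes the lemma
    valid for [n = 0] too. *)
Lemma site_hom_0_distinct (R : realType) (n : nat) :
  exists f g : site_hom R 0 n, f <> g.
Proof.
have one01 : (0 : R) <= (1 : R) <= (1 : R) by rewrite lexx ler01.
pose ones : Omega R := fun=> exist _ 1 one01.
pose zeros : Omega R := fun=> exist _ 0 (unit_interval0 R).
pose const w := SiteHom
  (mfun_of (@measurable_cst _ _ (Omega R) (Omega R) setT w))
  (@mixed_smooth_cst R 0 n 0).
exists (const zeros), (const ones).
move=> /(congr1 (fun h => sval (hom_Omega h zeros 0%N)))/= /esym/eqP.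
by rewrite oner_eq0.
Qed.

(** [R^0] is a point, so only the sample part carries information. *)
Lemma site_hom_00_bij (R : realType) : bijective (@hom_Omega R 0 0).
Proof.
exists (fun Phi => SiteHom Phi (@mixed_smooth_cst R 0 0 0)) => // f.
apply: hom_map_inj; apply/funext => x; congr pair.
by rewrite thinmx0 [RHS]thinmx0.
Qed.

Lemma iota_hom_inj (R : realType) (n : nat) : injective (@iota_hom R n).
Proof. by move=> s t /(congr1 (fun h => hom_rV h (0, point))). Qed.

Theorem proposition3p4 (R : realType) :
  [/\ (forall m n : nat,
         @is_product (site R) m n (m + n)%N (q1 R m n) (q2 R m n)),
      has_finite_nonempty_products (site R),
      (forall t : Ob (site R), ~ is_terminal t),
      bijective (@hom_Omega R 0 0) /\
      (exists f g : @Mor (site R) 0%N 0%N, f <> g) &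
      forall n : nat, (1 <= n)%N ->
        (exists f g : @Mor (site R) 0%N n, f <> g) /\
        injective (fun t0 : 'rV[R]_n => iota_hom t0 : @Mor (site R) 0%N n)].
Proof.
split.
- exact: site_is_product.
- apply: binary_to_finite_products => m n.
  by exists (m + n)%N, (q1 R m n), (q2 R m n); exact: site_is_product.
- move=> n term; have [f [g]] := site_hom_0_distinct R n; apply.
  by have [h [_ h_uniq]] := term 0%N; rewrite -(h_uniq f I) -(h_uniq g I).
- by split; [exact: site_hom_00_bij|exact: site_hom_0_distinct].
- by move=> n _; split; [exact: site_hom_0_distinct|exact: iota_hom_inj].
Qed.
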